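(* Let $P$ be a commutative Noetherian ring and let $A$ and $B$ be ideals of $P$ with $A\subseteq B^2$ such that $P/A$ and $P/B$ are both Artinian Gorenstein local rings. Assume that $B$ is generated by a regular $P$-sequence of length at least two. Let $R$ be the ring $R=P/(A:_PB)$. Then the second syzygy of the canonical module of $R$, viewed as an $R$-module, has a direct summand isomorphic to $B/B^2$.
   Context: For ideals $L,M$ of $P$, $(L:_PM)=\{x\in P\mid xM\subseteq L\}$. A second syzygy module of an $R$-module $M$ is an $R$-module $M'$ for which there is an exact sequence $0\to M'\to P_2\to P_1\to M\to 0$ with $P_1,P_2$ projective $R$-modules. By Schanuel's Lemma it is well defined only up to direct sum with a projective module; ''the second syzygy of $M$ has a direct summand isomorphic to $T$'' is understood in this sense, i.e. some second syzygy module of $M$ (with $P_1,P_2$ finitely generated) has a direct summand isomorphic to $T$. The canonical module of $R$ is $\omega_R=\operatorname{Hom}_{P/A}(R,P/A)\cong B/A$. The $P$-module $B/B^2$ is an $R$-module because $(A:_PB)B\subseteq A\subseteq B^2$. *)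

(* Defs.v *)
From HB Require Import structures.
From mathcomp Require Import all_boot all_algebra.
From mathcomp Require Import boolp functions.

Set Implicit Arguments.
Unset Strict Implicit.
Unset Printing Implicit Defensive.

Import GRing.Theory.
Local Open Scope ring_scope.
Local Open Scope quotient_scope.

(* Membership predicates are boolean; `[< _ >] turns an arbitrary proposition *)
(* into a boolean, so a boolean predicate is an arbitrary subset.             *)

(* The structure idealr of ring_quotient only covers proper ideals; here the  *)
(* unit ideal is allowed, since it is not clear a priori that (A : B) is      *)
(* proper. Consequently quotient rings live in comPzRingType.                 *)
HB.mixin Record isMulAbsorbing (P : pzRingType) (S : P -> bool) := {
  ideal_mull_subproof : forall a, {in S, forall u, a * u \in S} }.

#[short(type="ideal")]
HB.structure Definition Ideal (P : pzRingType) :=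
  {S of GRing.ZmodClosed P S & isMulAbsorbing P S}.

Definition ideal_closed (P : pzRingType) (S : {pred P}) : Prop :=
  0 \in S /\ forall a, {in S &, forall u v, a * u + v \in S}.

Lemma ideal_closedB (P : pzRingType) (S : {pred P}) :
  ideal_closed S -> zmod_closed S.
Proof. by case=> S0 lS; split=> // u v uS vS; rewrite addrC -mulN1r lS. Qed.

Lemma ideal_closedM (P : pzRingType) (S : {pred P}) :
  ideal_closed S -> forall a, {in S, forall u, a * u \in S}.
Proof. by case=> S0 lS a u uS; rewrite -[_ * _]addr0 lS. Qed.

Lemma ideal_mull (P : pzRingType) (A : ideal P) a x : x \in A -> a * x \in A.
Proof. exact: ideal_mull_subproof. Qed.

Section Ideals.
Variable P : comPzRingType.
Implicit Types A B : ideal P.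

Definition colon A B : {pred P} :=
  fun x => `[< forall y, y \in B -> x * y \in A >].

Lemma colonP A B x :
  reflect (forall y, y \in B -> x * y \in A) (x \in colon A B).
Proof. exact: asboolP. Qed.

Fact colon_closed A B : ideal_closed (colon A B).
Proof.
split=> [|a u v /colonP uP /colonP vP]; apply/colonP => y yB.
  by rewrite mul0r rpred0.
by rewrite mulrDl rpredD ?vP // -mulrA ideal_mull ?uP.
Qed.
HB.instance Definition _ A B :=
  GRing.isZmodClosed.Build P (colon A B) (ideal_closedB (colon_closed A B)).
HB.instance Definition _ A B :=
  isMulAbsorbing.Build P (colon A B) (ideal_closedM (colon_closed A B)).

Definition ideal_prod A B : {pred P} :=
  fun x => `[< exists n (a b : 'I_n -> P),
    [/\ forall i, a i \in A, forall i, b i \in B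
      & x = \sum_(i < n) a i * b i] >].

Fact ideal_prod_closed A B : ideal_closed (ideal_prod A B).
Proof.
split=> [|c u v /asboolP[n [a [b [aA bB uE]]]] /asboolP[m [d [e [dA eB vE]]]]];
  apply/asboolP.
  exists 0%N, (fun=> 0), (fun=> 0).
  by split=> [[]|[]|] //; rewrite big_ord0.
exists (n + m)%N.
exists (fun i => match fintype.split i with inl j => c * a j | inr j => d j end).
exists (fun i => match fintype.split i with inl j => b j | inr j => e j end).
split=> [i|i|]; try by case: (fintype.split i) => j //; rewrite ?ideal_mull.
rewrite big_split_ord /=; congr (_ + _).
  rewrite uE mulr_sumr; apply: eq_bigr => j _.
  by rewrite (unsplitK (inl j)) mulrA.
by rewrite vE; apply: eq_bigr => j _; rewrite (unsplitK (inr j)).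
Qed.
HB.instance Definition _ A B :=
  GRing.isZmodClosed.Build P (ideal_prod A B) (ideal_closedB (ideal_prod_closed A B)).
HB.instance Definition _ A B :=
  isMulAbsorbing.Build P (ideal_prod A B) (ideal_closedM (ideal_prod_closed A B)).

Definition ideal_gen (s : seq P) : {pred P} :=
  fun x => `[< exists c : 'I_(size s) -> P, x = \sum_(i < size s) c i * s`_i >].

Fact ideal_gen_closed s : ideal_closed (ideal_gen s).
Proof.
split=> [|a u v /asboolP[c uE] /asboolP[d vE]]; apply/asboolP.
  by exists (fun=> 0); rewrite big1 // => i _; rewrite mul0r.
exists (fun i => a * c i + d i); rewrite uE vE mulr_sumr -big_split.
by apply: eq_bigr => i _ /=; rewrite mulrDl mulrA.
Qed.
HB.instance Definition _ s :=
  GRing.isZmodClosed.Build P (ideal_gen s) (ideal_closedB (ideal_gen_closed s)).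
HB.instance Definition _ s :=
  isMulAbsorbing.Build P (ideal_gen s) (ideal_closedM (ideal_gen_closed s)).

End Ideals.

Section QuotientRing.
Variables (P : comPzRingType) (A : ideal P).

Definition qring : Type := Quotient.quot A.
HB.instance Definition _ := GRing.Zmodule.on qring.

Definition qproj (x : P) : qring := \pi_(Quotient.quot A) x.
Definition qlift (x : qring) : P := repr (x : (Quotient.quot A)).

Lemma qliftK : cancel qlift qproj. Proof. exact: reprK. Qed.

Lemma qprojE u v : qproj u = qproj v <-> u - v \in A.
Proof. by rewrite /qproj (Quotient.idealrBE A); split=> [->|/eqP]. Qed.

Lemma qprojB : zmod_morphism qproj.
Proof. exact: (raddfB \pi_(Quotient.quot A)). Qed.
HB.instance Definition _ := GRing.isZmodMorphism.Build P qring qproj qprojB.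

Definition qring_one : qring := qproj 1.
Definition qring_mul (x y : qring) : qring := qproj (qlift x * qlift y).

Lemma qring_mulE u v : qring_mul (qproj u) (qproj v) = qproj (u * v).
Proof.
have liftE w : qlift (qproj w) - w \in A by apply/qprojE/qliftK.
apply/qprojE; set u' := qlift _; set v' := qlift _.
have -> : u' * v' - u * v = u' * (v' - v) + v * (u' - u).
  by rewrite !mulrBr addrA [v * u']mulrC [v * u]mulrC addrNK.
by rewrite rpredD // ideal_mull // liftE.
Qed.

Fact qring_mulA : associative qring_mul.
Proof.
move=> x y z; rewrite -(qliftK x) -(qliftK y) -(qliftK z).
by rewrite !qring_mulE mulrA.
Qed.
Fact qring_mulC : commutative qring_mul.
Proof. by move=> x y; rewrite /qring_mul mulrC. Qed.
Fact qring_mul1 : left_id qring_one qring_mul.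
Proof. by move=> x; rewrite -(qliftK x) qring_mulE mul1r. Qed.
Fact qring_mulDl : left_distributive qring_mul +%R.
Proof.
move=> x y z; rewrite -(qliftK x) -(qliftK y) -(qliftK z).
by rewrite -raddfD !qring_mulE mulrDl raddfD.
Qed.
HB.instance Definition _ := GRing.Zmodule_isComPzRing.Build qring
  qring_mulA qring_mulC qring_mul1 qring_mulDl.

Lemma qproj_monoid_morphism : monoid_morphism qproj.
Proof. by split=> // u v; rewrite -qring_mulE. Qed.
HB.instance Definition _ :=
  GRing.isMonoidMorphism.Build P qring qproj qproj_monoid_morphism.

End QuotientRing.

Section QuotientMap.
Variables (P : comPzRingType) (A C : ideal P) (sAC : {subset A <= C}).

Definition qmap of {subset A <= C} := fun x : qring A => qproj C (qlift x).
Local Notation f := (qmap sAC).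

Lemma qmapE (x : P) : f (qproj A x) = qproj C x.
Proof. by apply/qprojE/sAC/qprojE/qliftK. Qed.

Lemma qmapB : zmod_morphism f.
Proof.
move=> x y; rewrite -(qliftK x) -(qliftK y) -raddfB.
by rewrite !qmapE raddfB.
Qed.
Lemma qmap_monoid_morphism : monoid_morphism f.
Proof.
split=> [|x y]; first by rewrite -(rmorph1 (qproj A)) qmapE rmorph1.
by rewrite -(qliftK x) -(qliftK y) -rmorphM !qmapE rmorphM.
Qed.
HB.instance Definition _ := GRing.isZmodMorphism.Build (qring A) (qring C) f qmapB.
HB.instance Definition _ :=
  GRing.isMonoidMorphism.Build (qring A) (qring C) f qmap_monoid_morphism.
End QuotientMap.

Definition restr (S R : pzRingType) (phi : {rmorphism S -> R})
  (M : lmodType R) : Type := M.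

Section RestrictionOfScalars.
Variables (S R : pzRingType) (phi : {rmorphism S -> R}) (M : lmodType R).
Local Notation V := (restr phi M).

HB.instance Definition _ := GRing.Zmodule.on V.

Definition restr_scale (s : S) (m : V) : V := phi s *: (m : M).

Fact restr_scaleA a b m :
  restr_scale a (restr_scale b m) = restr_scale (a * b) m.
Proof. by rewrite /restr_scale scalerA rmorphM. Qed.
Fact restr_scale1 : left_id 1 restr_scale.
Proof. by move=> m; rewrite /restr_scale rmorph1 scale1r. Qed.
Fact restr_scaleDr : right_distributive restr_scale +%R.
Proof. by move=> a m n; rewrite /restr_scale scalerDr. Qed.
Fact restr_scaleDl m : {morph restr_scale^~ m : a b / a + b}.
Proof. by move=> a b; rewrite /restr_scale rmorphD scalerDl. Qed.
HB.instance Definition _ := GRing.Zmodule_isLmodule.Build S V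
  restr_scaleA restr_scale1 restr_scaleDr restr_scaleDl.
End RestrictionOfScalars.

(* Hom_S(R, S) for phi : S -> R, as an R-module under (r f)(t) = f (r t).     *)
Section CanonicalModule.
Variables (S R : comPzRingType) (phi : {rmorphism S -> R}).

Definition linear_pred : {pred (restr phi R^o -> S^o)} := fun f => `[< linear f >].

Lemma linear_pred_closed : zmod_closed linear_pred.
Proof.
split=> [|f g /asboolP fl /asboolP gl]; apply/asboolP => a u v.
  by rewrite scaler0 addr0.
by rewrite !fctE fl gl scalerBr opprD addrACA.
Qed.
HB.instance Definition _ :=
  GRing.isZmodClosed.Build (restr phi R^o -> S^o) linear_pred linear_pred_closed.

Record canonical_module : Type := CanonicalModule {
  canonical_fun :> restr phi R^o -> S^o;
  canonical_funP : canonical_fun \in linear_pred }.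
HB.instance Definition _ := [isSub for canonical_fun].
HB.instance Definition _ := [Choice of canonical_module by <:].
HB.instance Definition _ := [SubChoice_isSubZmodule of canonical_module by <:].

Fact canonical_scale_subproof (r : R) (f : canonical_module) :
  (fun t : restr phi R^o => f (r * t : R)) \in linear_pred.
Proof.
apply/asboolP => a u v; have /asboolP fl := canonical_funP f.
by rewrite -fl; congr (f _); rewrite mulrDr [in LHS]mulrCA.
Qed.
Definition canonical_scale r f := CanonicalModule (canonical_scale_subproof r f).

Fact canonical_scaleA a b f :
  canonical_scale a (canonical_scale b f) = canonical_scale (a * b) f.
Proof. by apply/val_inj/funext => t /=; rewrite mulrCA mulrA. Qed.
Fact canonical_scale1 : left_id 1 canonical_scale.
Proof. by move=> f; apply/val_inj/funext => t /=; rewrite mul1r. Qed.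
Fact canonical_scaleDr : right_distributive canonical_scale +%R.
Proof. by move=> a f g; apply/val_inj/funext. Qed.
Fact canonical_scaleDl f : {morph canonical_scale^~ f : a b / a + b}.
Proof.
move=> a b; apply/val_inj/funext => t /=; have /asboolP fl := canonical_funP f.
have flD := fl 1 (a * t : R) (b * t : R).
rewrite !scale1r in flD; rewrite -[RHS]flD; congr (f _).
exact: (mulrDl (a : R) b t).
Qed.
HB.instance Definition _ := GRing.Zmodule_isLmodule.Build R canonical_module
  canonical_scaleA canonical_scale1 canonical_scaleDr canonical_scaleDl.
End CanonicalModule.

Lemma colon_sub (P : comPzRingType) (A B : ideal P) :
  {subset A <= colon A B}.
Proof. by move=> x xA; apply/colonP => y _; rewrite mulrC ideal_mull. Qed.

Section IdealModule.
Variables (P : comPzRingType) (B : ideal P).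

Record ideal_mod : Type := IdealMod {
  ideal_val :> P; ideal_valP : ideal_val \in B }.
HB.instance Definition _ := [isSub for ideal_val].
HB.instance Definition _ := [Choice of ideal_mod by <:].
HB.instance Definition _ := [SubChoice_isSubZmodule of ideal_mod by <:].

Definition ideal_scale (p : P) (b : ideal_mod) : ideal_mod :=
  IdealMod (ideal_mull p (ideal_valP b)).

Fact ideal_scaleA p q b : ideal_scale p (ideal_scale q b) = ideal_scale (p * q) b.
Proof. by apply/val_inj; rewrite /= mulrA. Qed.
Fact ideal_scale1 : left_id 1 ideal_scale.
Proof. by move=> b; apply/val_inj; rewrite /= mul1r. Qed.
Fact ideal_scaleDr : right_distributive ideal_scale +%R.
Proof. by move=> p b c; apply/val_inj; rewrite /= mulrDr. Qed.
Fact ideal_scaleDl b : {morph ideal_scale^~ b : p q / p + q}.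
Proof. by move=> p q; apply/val_inj; rewrite /= mulrDl. Qed.
HB.instance Definition _ := GRing.Zmodule_isLmodule.Build P ideal_mod
  ideal_scaleA ideal_scale1 ideal_scaleDr ideal_scaleDl.

Definition square_pred : {pred ideal_mod} :=
  fun b => ideal_val b \in ideal_prod B B.
Fact square_pred_closed : zmod_closed square_pred.
Proof.
by split=> [|b c bP cP]; rewrite unfold_in /square_pred ?rpred0 // rpredB.
Qed.
HB.instance Definition _ :=
  GRing.isZmodClosed.Build ideal_mod square_pred square_pred_closed.
End IdealModule.
Arguments square_pred {P} B.

(* B / B^2 as a module over P / (A : B), which acts because                   *)
(* (A : B) B <= A <= B^2.                                                     *)
Definition conormal (P : comPzRingType) (A B : ideal P)
  of {subset A <= ideal_prod B B} : Type := Quotient.quot (square_pred B).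

Section Conormal.
Variables (P : comPzRingType) (A B : ideal P).
Variable sAB2 : {subset A <= ideal_prod B B}.
Local Notation R := (qring (colon A B)).
Local Notation M := (conormal sAB2).

HB.instance Definition _ := GRing.Zmodule.on M.

Definition conormal_proj (b : ideal_mod B) : M := \pi_(Quotient.quot (square_pred B)) b.
Definition conormal_lift (m : M) : ideal_mod B :=
  repr (m : (Quotient.quot (square_pred B))).

Lemma conormal_liftK : cancel conormal_lift conormal_proj.
Proof. exact: reprK. Qed.

Lemma conormal_projE b c :
  conormal_proj b = conormal_proj c <-> ideal_val b - ideal_val c \in ideal_prod B B.
Proof.
have -> : (ideal_val b - ideal_val c \in ideal_prod B B) = (b - c \in square_pred B) by [].
by rewrite /conormal_proj Quotient.idealrBE; split=> [->|/eqP].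
Qed.

Lemma conormal_projB : zmod_morphism conormal_proj.
Proof. exact: (raddfB \pi_(Quotient.quot (square_pred B))). Qed.
HB.instance Definition _ :=
  GRing.isZmodMorphism.Build (ideal_mod B) M conormal_proj conormal_projB.

Definition conormal_scale (r : R) (m : M) : M :=
  conormal_proj (qlift r *: conormal_lift m).

Lemma conormal_scaleE (p : P) (b : ideal_mod B) :
  conormal_scale (qproj (colon A B) p) (conormal_proj b) = conormal_proj (p *: b).
Proof.
rewrite /conormal_scale; set q := qlift _; set c := conormal_lift _.
have /colonP qp : q - p \in colon A B by apply/qprojE/qliftK.
have cb : ideal_val c - ideal_val b \in ideal_prod B B by apply/conormal_projE/conormal_liftK.
apply/conormal_projE => /=.
have -> : q * ideal_val c - p * ideal_val b =
    (q - p) * ideal_val c + p * (ideal_val c - ideal_val b).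
  by rewrite mulrBl mulrBr addrA addrNK.
by apply: rpredD; [apply/sAB2/qp/ideal_valP | apply: ideal_mull].
Qed.

Fact conormal_scaleA a b m :
  conormal_scale a (conormal_scale b m) = conormal_scale (a * b) m.
Proof.
rewrite -(qliftK a) -(qliftK b) -(conormal_liftK m) -rmorphM.
by rewrite !conormal_scaleE scalerA.
Qed.
Fact conormal_scale1 : left_id 1 conormal_scale.
Proof.
move=> m; rewrite -(rmorph1 (qproj _)) -(conormal_liftK m).
by rewrite conormal_scaleE scale1r.
Qed.
Fact conormal_scaleDr : right_distributive conormal_scale +%R.
Proof.
move=> a m n; rewrite -(qliftK a) -(conormal_liftK m) -(conormal_liftK n).
by rewrite -raddfD !conormal_scaleE scalerDr raddfD.
Qed.
Fact conormal_scaleDl m : {morph conormal_scale^~ m : a b / a + b}.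
Proof.
move=> a b; rewrite -(qliftK a) -(qliftK b) -(conormal_liftK m).
by rewrite -raddfD !conormal_scaleE scalerDl raddfD.
Qed.
HB.instance Definition _ := GRing.Zmodule_isLmodule.Build R M
  conormal_scaleA conormal_scale1 conormal_scaleDr conormal_scaleDl.
End Conormal.

Section ModuleNotions.
Variable R : pzRingType.

Definition exact_at (L M N : lmodType R) (f : L -> M) (g : M -> N) : Prop :=
  forall m : M, g m = 0 <-> exists l : L, f l = m.

Definition surjective_map (T U : Type) (f : T -> U) : Prop :=
  forall u, exists t, f t = u.

Definition fin_gen (M : lmodType R) : Prop :=
  exists n (x : 'I_n -> M), forall m : M,
    exists c : 'I_n -> R, m = \sum_(i < n) c i *: x i.

Definition projective_module (M : lmodType R) : Prop :=
  forall (U V : lmodType R) (g : {linear U -> V}) (f : {linear M -> V}),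
    surjective_map g -> exists h : {linear M -> U}, forall m, g (h m) = f m.

Definition injective_module (M : lmodType R) : Prop :=
  forall (U V : lmodType R) (i : {linear U -> V}) (f : {linear U -> M}),
    injective i -> exists h : {linear V -> M}, forall u, h (i u) = f u.

Definition finite_injective_dimension (M : lmodType R) : Prop :=
  exists (n : nat) (I : nat -> lmodType R) (e : {linear M -> I 0%N})
         (d : forall k, {linear I k -> I k.+1}),
    [/\ forall k, injective_module (I k),
        injective e,
        exact_at e (d 0%N),
        forall k, exact_at (d k) (d k.+1)
      & forall k, (n < k)%N -> forall y : I k, y = 0].

Definition second_syzygy (M N : lmodType R) : Prop :=
  exists (P1 P2 : lmodType R) (i : {linear N -> P2}) (d : {linear P2 -> P1})
         (e : {linear P1 -> M}),
    [/\ projective_module P1 /\ fin_gen P1,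
        projective_module P2 /\ fin_gen P2,
        injective i, exact_at i d & exact_at d e /\ surjective_map e].

Definition module_iso (M N : lmodType R) : Prop :=
  exists f : {linear M -> N}, bijective f.

Definition has_summand_iso (N T : lmodType R) : Prop :=
  exists C : lmodType R, module_iso N (T * C)%type.

End ModuleNotions.

Section RingNotions.
Variable P : comPzRingType.

Definition noetherian : Prop :=
  forall A : ideal P, exists s : seq P, A =i ideal_gen s.

Definition artinian : Prop :=
  forall I : nat -> ideal P, (forall k, {subset I k.+1 <= I k}) ->
    exists n, forall k, (n <= k)%N -> I k =i I n.

Definition maximal_ideal (m : ideal P) : Prop :=
  1 \notin m /\
  forall I : ideal P, 1 \notin I -> {subset m <= I} -> I =i m.

Definition local_ring : Prop :=
  exists m : ideal P,
    maximal_ideal m /\ forall m' : ideal P, maximal_ideal m' -> m' =i m.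

(* Meant for local Noetherian rings; Artinian rings are Noetherian.           *)
Definition gorenstein : Prop := finite_injective_dimension P^o.

Definition artinian_gorenstein_local : Prop :=
  [/\ artinian, local_ring & gorenstein].

Definition regular_sequence (s : seq P) : Prop :=
  (forall i, (i < size s)%N ->
     GRing.lreg (qproj (ideal_gen (take i s)) s`_i)) /\
  1 \notin ideal_gen s.

End RingNotions.

(* Main.v *)
(* Write J = (A : B), R = P/J, and let B = (x_1, ..., x_n). Since P/A is       *)
(* self-injective, the canonical module of R is B/A, and J/A = Hom(P/B, P/A)   *)
(* is cyclic, generated by some D, and isomorphic to P/B. Choose generators    *)
(* g_1, ..., g_m of the module of vectors p in P^n with sum_i p_i x_i in A.    *)
(* By regularity their entries lie in B, so the second syzygy                  *)
(* N = ker(R^m -> R^n) has a well-defined map psi to (J/A)^n, sending v to     *)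
(* sum_l v_l g_l modulo A. For every s there is an element of N killed by B    *)
(* that psi maps to D e_s: take s' <> s (this needs n >= 2) and u in P with    *)
(* u x_s' = D and u x_t = 0 for t <> s' modulo A, which exists because B/B^2   *)
(* is free over P/B and P/A is self-injective, and multiply by u a lift of the *)
(* Koszul relation x_s' e_s - x_s e_s'. Hence psi splits, and                  *)
(* (J/A)^n = (P/B)^n = B/B^2 is a direct summand of N.                         *)

From HB Require Import structures.
Require Import Defs.
From mathcomp Require Import all_boot all_algebra.
From mathcomp Require Import boolp.

Set Implicit Arguments.
Unset Strict Implicit.
Unset Printing Implicit Defensive.

Import GRing.Theory.
Local Open Scope ring_scope.

(** All the duality comes from self-injectivity of P/A, and only for maps from cyclic submodules of
    cyclic modules ([cyclic_ext]). [gorenstein_cyclic_ext] obtains it by descending along a finite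
    injective resolution. The descent step [cyclic_ext_ker] works because, over an Artinian local
    ring and for a map whose source and image have this extension property, an element of the image
    killed by an ideal lifts to an element killed by the same ideal ([lift_killed]). Read modulo A,
    self-injectivity gives three facts: every functional R -> P/A is multiplication by an element of
    B ([colon_annihilator], [theta_surj]), J/A is a copy of P/B generated by D ([colon_generator]),
    and the functional on B/A sending one generator of B to D and the others to 0 is multiplication
    by an element of P ([dual_element]).

    The regular sequence enters through [regular_sequence_coef]: since A <= B^2, the coefficients of
    a relation modulo A lie in B. Hence psi : N -> (J/A)^n is well defined; [koszul_section]
    provides preimages, killed by B, of the basis D e_s, and these span a copy of (P/B)^n = B/B^2
    that complements the kernel of psi. *)

Section BundledIdeals.
Variable P : comPzRingType.

(** A copy of [S] that carries its closure proof, so that a predicate built inside a proof can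
    receive the ideal structure. *)
Definition bundle_ideal (S : {pred P}) of ideal_closed S : {pred P} := S.
HB.instance Definition _ (S : {pred P}) (cS : ideal_closed S) :=
  GRing.isZmodClosed.Build P (bundle_ideal cS) (ideal_closedB cS).
HB.instance Definition _ (S : {pred P}) (cS : ideal_closed S) :=
  isMulAbsorbing.Build P (bundle_ideal cS) (ideal_closedM cS).

Lemma ideal_mulr (A : ideal P) a x : x \in A -> x * a \in A.
Proof. by rewrite mulrC; exact: ideal_mull. Qed.

Lemma ideal_gen_mem (s : seq P) x : x \in s -> x \in ideal_gen s.
Proof.
move=> xs; have i_lt : (index x s < size s)%N by rewrite index_mem.
apply/asboolP; exists (fun j => (j == Ordinal i_lt)%:R).
rewrite (bigD1 (Ordinal i_lt)) //= eqxx mul1r nth_index // big1 ?addr0 //.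
by move=> j /negbTE ->; rewrite mul0r.
Qed.

Lemma ideal_gen_sub (s : seq P) (A : ideal P) :
  {subset s <= A} -> {subset ideal_gen s <= A}.
Proof.
move=> sA x /asboolP[c ->]; apply: rpred_sum => i _.
by apply/ideal_mull/sA/mem_nth.
Qed.

Lemma ideal_gen1P (y x : P) :
  reflect (exists c, x = c * y) (x \in ideal_gen [:: y]).
Proof.
apply: (iffP (asboolP _)) => [[c ->]|[c ->]].
  by exists (c ord0); rewrite big_ord1.
by exists (fun=> c); rewrite big_ord1.
Qed.

Definition ideal_add (A B : ideal P) : {pred P} :=
  fun x => `[< exists2 a, a \in A & x - a \in B >].

Fact ideal_add_closed A B : ideal_closed (ideal_add A B).
Proof.
split=> [|c u v /asboolP[a aA uaB] /asboolP[b bA vbB]]; apply/asboolP.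
  by exists 0; rewrite ?subr0 rpred0.
exists (c * a + b); first by rewrite rpredD ?ideal_mull.
by rewrite opprD addrACA -mulrBr rpredD ?ideal_mull.
Qed.
HB.instance Definition _ A B :=
  GRing.isZmodClosed.Build P (ideal_add A B)
    (ideal_closedB (ideal_add_closed A B)).
HB.instance Definition _ A B :=
  isMulAbsorbing.Build P (ideal_add A B) (ideal_closedM (ideal_add_closed A B)).

Lemma ideal_addP (A B : ideal P) x :
  reflect (exists2 a, a \in A & x - a \in B) (x \in ideal_add A B).
Proof. exact: asboolP. Qed.

Lemma ideal_add_l (A B : ideal P) : {subset A <= ideal_add A B}.
Proof. by move=> a aA; apply/ideal_addP; exists a; rewrite ?subrr ?rpred0. Qed.

Lemma ideal_add_r (A B : ideal P) : {subset B <= ideal_add A B}.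
Proof. by move=> b bB; apply/ideal_addP; exists 0; rewrite ?subr0 ?rpred0. Qed.

Fact ideal0_closed : ideal_closed (pred1 (0 : P)).
Proof.
split=> [|a u v]; first by rewrite inE.
by rewrite !inE => /eqP-> /eqP->; rewrite mulr0 addr0.
Qed.
Definition ideal0 : ideal P := bundle_ideal ideal0_closed.

(** Otherwise choice builds a strictly ascending chain above [I0]; its union is finitely generated,
    so some member already contains the next one. [Q] is arbitrary because it serves both for proper
    ideals and for maximal counterexamples. *)
Lemma noetherian_maximal (Q : ideal P -> Prop) (I0 : ideal P) :
    noetherian P -> Q I0 ->
  exists I : ideal P, [/\ Q I, {subset I0 <= I} &
    forall K : ideal P, Q K -> {subset I <= K} -> {subset K <= I}].
Proof.
move=> noethP QI0; apply: contrapT => nomax.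
pose good (I : ideal P) := Q I /\ {subset I0 <= I}.
have /choice[next nextP] : forall I : {I | good I}, exists K : {I | good I},
    {subset sval I <= sval K} /\ ~ {subset sval K <= sval I}.
  move=> [I [QI sI]]; apply: contrapT => noK; apply: nomax.
  exists I; split=> // K QK sIK; apply: contrapT => nsKI; apply: noK.
  have gK : good K by split=> // x /sI/sIK.
  by exists (exist good K gK).
have g0 : good I0 by split.
pose I k := sval (iter k next (exist good I0 g0)).
have Imono j k : (j <= k)%N -> {subset I j <= I k}.
  elim: k => [|k IHk]; first by rewrite leqn0 => /eqP->.
  rewrite leq_eqVlt => /orP[/eqP-> //|]; rewrite ltnS => /IHk jk x /jk.
  by case: (nextP (iter k next (exist good I0 g0))) => + _; apply.
pose U : {pred P} := fun x => `[< exists k, x \in I k >].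
have cU : ideal_closed U.
  split=> [|a u v /asboolP[j uj] /asboolP[k vk]]; apply/asboolP.
    by exists 0%N; rewrite rpred0.
  exists (maxn j k); rewrite rpredD ?ideal_mull //.
    exact: Imono (leq_maxl _ _) _ uj.
  exact: Imono (leq_maxr _ _) _ vk.
have [s sU] := noethP (bundle_ideal cU).
have [k sk] : exists k, {subset s <= I k}.
  have : {subset s <= U} by move=> x xs; have := ideal_gen_mem xs; rewrite -sU.
  elim: s {sU} => [|x s IHs] sU; first by exists 0%N.
  have /asboolP[j xj] := sU x (mem_head _ _).
  have [|k sk] := IHs; first by move=> y ys; apply: sU; rewrite inE ys orbT.
  exists (maxn j k) => y; rewrite inE => /orP[/eqP->|/sk].
    exact: Imono (leq_maxl _ _) _ xj.
  exact: Imono (leq_maxr _ _) _.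
have [_ []] := nextP (iter k next (exist good I0 g0)).
move=> x xk; apply: (ideal_gen_sub sk); rewrite -sU.
by apply/asboolP; exists k.+1.
Qed.

End BundledIdeals.

(* Maps (I + Sy) / I -> Z extend to S / I. This fragment of injectivity, for  *)
(* subsets Z of a module, suffices below and passes from the terms and the    *)
(* cokernels of a resolution to its kernels without any use of Zorn's lemma.  *)
Definition cyclic_ext (S : comPzRingType) (M : lmodType S) (Z : M -> Prop) :=
  forall (I : ideal S) (y : S) (w : M), Z w ->
    (forall p, p * y \in I -> p *: w = 0) ->
  exists z, [/\ Z z, forall a, a \in I -> a *: z = 0 & y *: z = w].

(** Multiplication by [y] embeds S/(I : y) into S/I, and 1 |-> [w] is well defined on S/(I : y).
    Extending the latter map to S/I, the image of 1 is the required element. *)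
Lemma injective_cyclic_ext (S : comPzRingType) (M : lmodType S) :
  injective_module M -> cyclic_ext (fun _ : M => True).
Proof.
move=> injM I y w _ wP.
pose K := colon I (ideal_gen [:: y]).
have KP p : p \in K <-> p * y \in I.
  split=> [/colonP|pyI]; first by apply; apply: ideal_gen_mem; rewrite inE.
  by apply/colonP => _ /ideal_gen1P[c ->]; rewrite mulrCA ideal_mull.
pose U : lmodType S := restr (qproj K) (qring K)^o.
pose V : lmodType S := restr (qproj I) (qring I)^o.
have scaleE (L : ideal S) a x :
    a *: (qproj L x : restr (qproj L) (qring L)^o) = qproj L (a * x).
  by rewrite rmorphM.
pose i (u : U) : V := qproj I (qlift u * y).
have iE p : i (qproj K p) = qproj I (p * y).
  by apply/qprojE; rewrite -mulrBl; apply/KP/qprojE/qliftK.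
pose f (u : U) : M := qlift u *: w.
have fE p : f (qproj K p) = p *: w.
  apply/eqP; rewrite -subr_eq0 -scalerBl; apply/eqP/wP/KP/qprojE/qliftK.
have i_lin : linear i.
  move=> a u v; rewrite -(qliftK u) -(qliftK v) scaleE -raddfD !iE scaleE.
  by rewrite -raddfD mulrDl mulrA.
have f_lin : linear f.
  move=> a u v; rewrite -(qliftK u) -(qliftK v) scaleE -raddfD !fE.
  by rewrite scalerDl scalerA.
pose iL := HB.pack_for {linear U -> V} i (GRing.isLinear.Build S U V _ i i_lin).
pose fL := HB.pack_for {linear U -> M} f (GRing.isLinear.Build S U M _ f f_lin).
have i_inj : injective iL.
  move=> u v; rewrite -(qliftK u) -(qliftK v) /= !iE => /qprojE.
  by rewrite -mulrBl => /KP/qprojE.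
have [h hE] := injM U V iL fL i_inj.
have hp p : p *: h (qproj I 1 : V) = h (qproj I p : V).
  by rewrite -linearZ scaleE mulr1.
exists (h (qproj I 1 : V)); split=> // [a aI|].
  rewrite hp -(linear0 h); congr (h _).
  by rewrite -(rmorph0 (qproj I)); apply/qprojE; rewrite subr0.
rewrite hp; have := hE (qproj K 1); rewrite /= iE fE mul1r scale1r.
by move=> ->.
Qed.

(** * Self-injectivity of Artinian Gorenstein local rings *)

Section LocalArtinian.
Variable S : comPzRingType.
Hypotheses (noethS : noetherian S) (artS : artinian S).
Variable m : ideal S.
Hypothesis maxm : maximal_ideal m.
Hypothesis uniqm : forall m' : ideal S, maximal_ideal m' -> m' =i m.

Lemma local_unit p : p \notin m -> exists q, q * p = 1.
Proof.
move=> pm; apply: contrapT => nounit.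
have pN1 : 1 \notin ideal_gen [:: p].
  by apply/negP => /ideal_gen1P[c c1]; apply: nounit; exists c.
have [M [M1 pM Mmax]] :=
  @noetherian_maximal S (fun I => 1 \notin I) _ noethS pN1.
have /uniqm Mm : maximal_ideal M.
  by split=> // I I1 sMI x; apply/idP/idP; [exact: Mmax | exact: sMI].
by case/negP: pm; rewrite -Mm; apply/pM/ideal_gen_mem; rewrite inE.
Qed.

(** Otherwise every multiple q x outside [I] can be multiplied by some element of [m] without
    falling into [I]. The descending ideals I + (q x) so obtained stabilize, and Nakayama's argument
    (1 - c p is a unit for p in [m]) puts some q x into [I]. *)
Lemma artinian_socle (I : ideal S) x : x \notin I ->
  exists q, q * x \notin I /\ forall p, p \in m -> p * (q * x) \in I.
Proof.
move=> xI; apply: contrapT => nosoc.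
have /choice[next nextP] : forall q : {q | q * x \notin I}, exists p,
    p \in m /\ p * (sval q * x) \notin I.
  move=> [q qI] /=; apply: contrapT => nop; apply: nosoc.
  exists q; split=> // p pm; apply: contrapT => /negP pI.
  by apply: nop; exists p.
have step (q : {q | q * x \notin I}) : next q * sval q * x \notin I.
  by rewrite -mulrA; case: (nextP q).
have x1 : 1 * x \notin I by rewrite mul1r.
pose Q k := iter k (fun q => exist (fun q => q * x \notin I) _ (step q))
  (exist (fun q => q * x \notin I) 1 x1).
pose K k : ideal S := ideal_add I (ideal_gen [:: sval (Q k) * x]).
have Kdec k : {subset K k.+1 <= K k}.
  move=> y /ideal_addP[a aI /ideal_gen1P[c yE]]; apply/ideal_addP.
  exists a => //; rewrite yE /= -mulrA.
  by apply/ideal_mull/ideal_mull/ideal_gen_mem; rewrite inE.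
have [n nP] := artS Kdec.
have : sval (Q n) * x \in K n.+1.
  by rewrite (nP n.+1 (leqnSn n)); apply/ideal_add_r/ideal_gen_mem; rewrite inE.
case/ideal_addP => a aI /ideal_gen1P[c]; set p := next (Q n) => E.
have [pm _] := nextP (Q n).
have /local_unit[d dE] : 1 - c * p \notin m.
  case: maxm => m1 _; apply: contra m1 => h.
  by rewrite -(subrK (c * p) 1) rpredD // ideal_mull.
have := svalP (Q n) => /= /negP[].
rewrite -[_ * x]mul1r -dE -mulrA ideal_mull // mulrBl mul1r.
suff -> : sval (Q n) * x - c * p * (sval (Q n) * x) = a by [].
by move: E; rewrite /= -!mulrA => <-; rewrite subKr.
Qed.




Lemma socle_exists : exists s, s != 0 /\ forall p, p \in m -> p * s = 0.
Proof.
have [m1 _] := maxm.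
have S1 : 1 \notin ideal0 S.
  by apply: contra m1 => /eqP ->; rewrite rpred0.
have [q [q0 qm]] := artinian_socle S1.
by exists (q * 1); split=> // p /qm/eqP.
Qed.

Lemma socle_annihilator s p : s != 0 ->
  (forall p, p \in m -> p * s = 0) -> p * s = 0 -> p \in m.
Proof.
move=> s0 ms ps; apply: contraR s0 => /local_unit[q qp].
by rewrite -[s]mul1r -qp -mulrA ps mulr0.
Qed.

(** * Passing the extension property from the image of a map to its kernel *)

Section CosyzygyStep.
Variables (X Y : lmodType S) (d : {linear X -> Y}).
Hypothesis extX : cyclic_ext (fun _ : X => True).
Hypothesis extY : cyclic_ext (fun y : Y => exists x, d x = y).

(* Elements killed by m can be divided by a socle element s in the image, and *)
(* s times any lift of the quotient is killed by m.                           *)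
Lemma lift_killed_by_max x : (forall p, p \in m -> p *: d x = 0) ->
  exists x', d x' = d x /\ forall p, p \in m -> p *: x' = 0.
Proof.
move=> mx; have [s [s0 ms]] := socle_exists.
have [_ [[w <-] _ sw]] : exists z, [/\ exists x, d x = z,
    forall a, a \in ideal0 S -> a *: z = 0 & s *: z = d x].
  apply: extY; first by exists x.
  by move=> p /eqP ps; apply/mx/(socle_annihilator s0 ms).
exists (s *: w); split; first by rewrite linearZ.
by move=> p /ms ps; rewrite scalerA ps scale0r.
Qed.

(** Noetherian induction. Let [I] be a maximal counterexample and [y] a socle element modulo [I].
    Then y d(x) is killed by [m], so it lifts to some [x1] killed by [m], and the extension property
    of [X] writes [x1] as y x2 with I x2 = 0. Now d(x - x2) is killed by the larger ideal I + Sy,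
    for which the claim holds. *)
Lemma lift_killed (I : ideal S) x : (forall p, p \in I -> p *: d x = 0) ->
  exists x', d x' = d x /\ forall p, p \in I -> p *: x' = 0.
Proof.
pose bad (I : ideal S) := exists x, (forall p, p \in I -> p *: d x = 0) /\
  ~ exists x', d x' = d x /\ forall p, p \in I -> p *: x' = 0.
move=> Ix; apply: contrapT => Ibad.
have : bad I by exists x.
case/(noetherian_maximal noethS) => {x I Ix Ibad} I [[x [Ix nox]] _ Imax].
apply: nox; have [I1|I1] := boolP (1 \in I).
  exists 0; have := Ix 1 I1; rewrite scale1r => ->.
  by rewrite linear0; split=> // p _; rewrite scaler0.
have [y []] := artinian_socle I1; rewrite mulr1 => yI my.
have [x1 [dx1 mx1]] : exists x', d x' = d (y *: x) /\
    forall p, p \in m -> p *: x' = 0.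
  apply: lift_killed_by_max => p pm.
  by rewrite linearZ scalerA Ix ?my.
have [x2 [_ Ix2 yx2]] : exists z, [/\ True,
    forall a, a \in I -> a *: z = 0 & y *: z = x1].
  apply: extX => // p pyI; apply: mx1; apply: contraR yI => /local_unit[q qp].
  by rewrite -[y]mul1r -qp -mulrA ideal_mull.
pose K : ideal S := ideal_add I (ideal_gen [:: y]).
have Kx p : p \in K -> p *: d (x - x2) = 0.
  case/ideal_addP => a aI /ideal_gen1P[c /eqP]; rewrite subr_eq => /eqP->.
  rewrite scalerDl -scalerA -[y *: _]linearZ scalerBr yx2 (linearB d) dx1 subrr.
  by rewrite scaler0 add0r (linearB d) scalerBr Ix // -linearZ Ix2 //
    linear0 subr0.
have [x3 [dx3 Kx3]] : exists x', d x' = d (x - x2) /\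
    forall p, p \in K -> p *: x' = 0.
  apply: contrapT => nox; case/negP: yI; apply: (Imax K).
  - by exists (x - x2).
  - exact: ideal_add_l.
  - by apply/ideal_add_r/ideal_gen_mem; rewrite inE.
exists (x3 + x2); split; first by rewrite linearD dx3 -linearD subrK.
by move=> p pI; rewrite scalerDr Kx3 ?Ix2 ?addr0 //; apply: ideal_add_l.
Qed.

(** An extension [x] found in [X] may have d x <> 0, but d x is killed by I + Sy. Subtracting a lift
    of d x that is itself killed by I + Sy moves [x] into the kernel without changing I x and y
    x. *)
Lemma cyclic_ext_ker : cyclic_ext (fun x : X => d x = 0).
Proof.
move=> I y w dw wP.
have [x [_ Ix yx]] : exists z, [/\ True,
    forall a, a \in I -> a *: z = 0 & y *: z = w] by exact: extX.
have Kx p : p \in ideal_add I (ideal_gen [:: y]) -> p *: d x = 0.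
  case/ideal_addP => a aI /ideal_gen1P[c /eqP]; rewrite subr_eq => /eqP->.
  by rewrite -linearZ scalerDl -scalerA yx Ix // addr0 linearZ_LR dw scaler0.
have [x' [dx' Kx']] := lift_killed Kx.
exists (x - x'); split; first by rewrite linearB dx' subrr.
  by move=> a aI; rewrite scalerBr Ix // Kx' ?subr0 //; apply: ideal_add_l.
rewrite scalerBr yx Kx' ?subr0 //.
by apply/ideal_add_r/ideal_gen_mem; rewrite inE.
Qed.

End CosyzygyStep.

Lemma gorenstein_cyclic_ext : gorenstein S -> cyclic_ext (fun _ : S^o => True).
Proof.
case=> n [I [e [d [injI inj_e exe exd I0]]]].
(* [j] counts the steps down from the zero term I (n+1); by exactness the image of [d k] is the
   kernel of [d k.+1], so [cyclic_ext_ker] applies. *)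
have ext_d j k : (j + k = n.+1)%N -> cyclic_ext (fun x : I k => d k x = 0).
  elim: j k => [|j IHj] k jk.
    move=> K y w _ _; have w0 : w = 0 by apply: I0; rewrite -jk.
    by exists 0; split=> [|a _|]; rewrite ?linear0 ?scaler0 ?w0.
  apply: cyclic_ext_ker; first exact/injective_cyclic_ext/injI.
  move=> K y w /exd wk wP; have [|z [zk Kz yz]] := IHj k.+1 _ K y w wk wP.
    by rewrite addnS -addSn.
  by exists z; split=> //; apply/exd.
move=> K y w _ wP.
have [|||z [/exe[z' <-] Kz yz]] := ext_d n.+1 0%N _ K y (e w).
- by rewrite addn0.
- by apply/exe; exists w.
- by move=> p /wP pw; rewrite -linearZ pw linear0.
exists z'; split=> // [a aK|]; apply: inj_e; rewrite linearZ ?linear0 //.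
exact: Kz.
Qed.

(** A nonzero [y] has a nonzero multiple q y killed by [m]. The map q y |-> [s] is then well
    defined, and self-injectivity makes it multiplication by a ring element. *)
Lemma gorenstein_simple_socle : gorenstein S -> exists s,
  [/\ s != 0, forall p, p \in m -> p * s = 0 &
      forall y, y != 0 -> exists q, q * y = s].
Proof.
move=> /gorenstein_cyclic_ext extS.
have [s [s0 ms]] := socle_exists; exists s; split=> // y y0.
have [q [qy0 qym]] : exists q, q * y \notin ideal0 S /\
    forall p, p \in m -> p * (q * y) \in ideal0 S by exact: artinian_socle.
have [z [_ _ <-]] : exists z : S^o, [/\ True,
    forall a, a \in ideal0 S -> a *: z = 0 & (q * y) *: z = s].
  apply: extS => // p /eqP pqy; apply: ms; apply: socle_annihilator pqy => //.
  by move=> r /qym/eqP.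
by exists (z * q); rewrite -mulrA mulrC.
Qed.

End LocalArtinian.

(** The nontrivial half of ann(ann I) = I: a multiple of [y] lies in the socle modulo [I], and the
    extension property maps it to a nonzero socle element of [S]. *)
Lemma gorenstein_double_annihilator (S : comPzRingType) (I : ideal S) (y : S) :
    noetherian S -> artinian_gorenstein_local S -> y \notin I ->
  exists z, (forall a, a \in I -> a * z = 0) /\ y * z != 0.
Proof.
move=> noethS [artS [m [maxm uniqm]] gorS] yI.
have [s [s0 ms]] := socle_exists noethS artS maxm uniqm.
have [q [qyI mqy]] := artinian_socle noethS artS maxm uniqm yI.
have extS := gorenstein_cyclic_ext noethS artS maxm uniqm gorS.
have [|z [_ Iz qyz]] := extS I (q * y) s Logic.I.
  move=> p pqy; apply: ms; apply: contraR qyI => /(local_unit noethS uniqm).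
  by case=> r rp; rewrite -[q * y]mul1r -rp -mulrA ideal_mull.
exists z; split=> //; apply: contra s0 => /eqP yz.
have <- : q * y * z = s by [].
by rewrite -mulrA yz mulr0.
Qed.

(** * Self-injectivity of P/A expressed by congruences in P *)

Section GorensteinQuotient.
Variables (P : comPzRingType) (A : ideal P).
Hypothesis noethP : noetherian P.

Lemma qproj_eq0 p : qproj A p = 0 <-> p \in A.
Proof. by rewrite -(rmorph0 (qproj A)) qprojE subr0. Qed.

Lemma qring_noetherian : noetherian (qring A).
Proof.
move=> I; pose K : {pred P} := fun p => qproj A p \in I.
have cK : ideal_closed K.
  have KE p : (p \in K) = (qproj A p \in I) by [].
  split=> [|a u v]; rewrite !KE ?rmorph0 ?rpred0 // => uI vI.
  by rewrite rmorphD rmorphM rpredD ?ideal_mull.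
have [s sK] := noethP (bundle_ideal cK); exists [seq qproj A x | x <- s] => x.
apply/idP/idP => [xI|].
  have /asboolP[c cE] : qlift x \in ideal_gen s.
    by rewrite -sK -[_ \in _]/(qproj A (qlift x) \in I) qliftK.
  rewrite -(qliftK x) cE rmorph_sum; apply: rpred_sum => i _.
  rewrite rmorphM; apply/ideal_mull/ideal_gen_mem/map_f/mem_nth/ltn_ord.
apply: ideal_gen_sub => _ /mapP[p ps ->].
by have := ideal_gen_mem ps; rewrite -sK.
Qed.

Section ImageIdeal.
Variable I : ideal P.

Hypothesis sAI : {subset A <= I}.

Definition qring_image_pred : {pred qring A} := fun x => qlift x \in I.

Lemma mem_qring_image_pred p : (qproj A p \in qring_image_pred) = (p \in I).
Proof.
have /sAI h : qlift (qproj A p) - p \in A by apply/qprojE/qliftK.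
rewrite -[LHS]/(qlift (qproj A p) \in I).
apply/idP/idP => ?; first by rewrite -[p](subKr (qlift (qproj A p))) rpredB.
by rewrite -[qlift _](subrK p) rpredD.
Qed.

Fact qring_image_closed : ideal_closed qring_image_pred.
Proof.
split=> [|a u v].
  by rewrite -(rmorph0 (qproj A)) mem_qring_image_pred rpred0.
rewrite -(qliftK a) -(qliftK u) -(qliftK v) -rmorphM -rmorphD.
by rewrite !mem_qring_image_pred => uI vI; rewrite rpredD ?ideal_mull.
Qed.
Definition qring_image : ideal (qring A) := bundle_ideal qring_image_closed.

Lemma mem_qring_image p : (qproj A p \in qring_image) = (p \in I).
Proof. exact: mem_qring_image_pred. Qed.
End ImageIdeal.

Hypothesis gorA : artinian_gorenstein_local (qring A).

Lemma quotient_cyclic_ext (I : ideal P) y w : {subset A <= I} ->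
    (forall p, p * y \in I -> p * w \in A) ->
  exists z, (forall a, a \in I -> a * z \in A) /\ y * z - w \in A.
Proof.
move=> sAI wP; have [artA [m [maxm uniqm]] gA] := gorA.
have extA := gorenstein_cyclic_ext qring_noetherian artA maxm uniqm gA.
have [|z [_ Iz yz]] := extA (qring_image sAI) (qproj A y) (qproj A w) Logic.I.
  move=> p; rewrite -(qliftK p) -rmorphM mem_qring_image => /wP/qproj_eq0.
  by rewrite rmorphM.
exists (qlift z); split=> [a aI|]; last first.
  by apply/qprojE; rewrite rmorphM /= qliftK.
by apply/qproj_eq0; rewrite rmorphM /= qliftK; apply: Iz;
  rewrite mem_qring_image.
Qed.

Lemma quotient_double_annihilator (I : ideal P) y : {subset A <= I} ->
  (forall z, (forall a, a \in I -> a * z \in A) -> y * z \in A) -> y \in I.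
Proof.
move=> sAI yz; apply: contrapT => /negP.
rewrite -(mem_qring_image sAI).
case/(gorenstein_double_annihilator qring_noetherian gorA) => z [Iz /negP[]].
rewrite -(qliftK z) -rmorphM; apply/eqP/qproj_eq0/yz => a aI.
apply/qproj_eq0; rewrite rmorphM /= qliftK.
by apply: Iz; rewrite mem_qring_image.
Qed.

(** The socle of P/A described without its maximal ideal: an element outside the maximal ideal is a
    unit, whence the alternative in the second clause; the third clause says that every nonzero
    ideal contains the socle generator. *)
Lemma quotient_socle : exists s, [/\ s \notin A,
    forall p, p * s \in A \/ exists q, q * p - 1 \in A &
    forall y, y \notin A -> exists q, q * y - s \in A].
Proof.
have [artA [m [maxm uniqm]] gA] := gorA.
have noethA := qring_noetherian.
have [s [s0 ms sy]] := gorenstein_simple_socle noethA artA maxm uniqm gA.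
exists (qlift s); split.
- by apply/negP => /qproj_eq0; rewrite qliftK => /eqP; rewrite (negbTE s0).
- move=> p; have [pm|/(local_unit noethA uniqm)[q qp]] := boolP (qproj A p \in m);
    [left|right].
    by apply/qproj_eq0; rewrite rmorphM /= qliftK ms.
  exists (qlift q).
  by apply/qprojE; rewrite rmorphM /= qliftK rmorph1.
- move=> y yA; have [|q qy] := sy (qproj A y).
    by apply/eqP => /qproj_eq0; apply/negP.
  by exists (qlift q); apply/qprojE; rewrite rmorphM /= !qliftK.
Qed.

End GorensteinQuotient.

(** * Relations on a regular sequence *)

Section RegularSequences.
Variable P : comPzRingType.

(** Coefficients are indexed by [nat], with default 0, so that inductions can change the length of a
    relation without casts. *)
Lemma ideal_gen_nat (s : seq P) x : x \in ideal_gen s ->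
  exists c : nat -> P, x = \sum_(i < size s) c i * s`_i.
Proof.
case/asboolP => c ->; exists (fun i => oapp c 0 (insub i)).
by apply: eq_bigr => i _; rewrite valK.
Qed.

Lemma ideal_prod_gen (I J : ideal P) (s : seq P) x : J =i ideal_gen s ->
    x \in ideal_prod I J ->
  exists b : 'I_(size s) -> P,
    (forall i, b i \in I) /\ x = \sum_i b i * s`_i.
Proof.
move=> Js /asboolP[n [a [b [aI bJ ->]]]].
have /choice[c bE] : forall k, exists c : 'I_(size s) -> P,
    b k = \sum_i c i * s`_i.
  by move=> k; apply/asboolP; rewrite -[asbool _]/(b k \in ideal_gen s) -Js.
exists (fun i => \sum_k a k * c k i); split.
  by move=> i; apply: rpred_sum => k _; rewrite ideal_mulr.
under eq_bigr => k _ do rewrite bE mulr_sumr.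
rewrite exchange_big /=; apply: eq_bigr => i _; rewrite mulr_suml.
by apply: eq_bigr => k _; rewrite mulrA.
Qed.

Lemma ideal_gen_take_sub (s : seq P) k : (k < size s)%N ->
  {subset ideal_gen (take k s) <= ideal_gen (take k.+1 s)}.
Proof.
move=> ks; apply: ideal_gen_sub => x xs; apply: ideal_gen_mem.
by rewrite (take_nth 0 ks) mem_rcons inE xs orbT.
Qed.

(** Regularity puts the last coefficient [p k] into the ideal of the earlier terms. Substituting p_k
    = sum_i c_i x_i leaves a relation of length [k] with coefficients p_i + c_i x_k, to which
    induction applies. *)
Lemma regular_sequence_syzygy (s : seq P) k (p : nat -> P) :
    regular_sequence s -> (k <= size s)%N ->
    \sum_(i < k) p i * s`_i = 0 ->
  forall i, (i < k)%N -> p i \in ideal_gen (take k s).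
Proof.
move=> [regs _]; elim: k p => // k IHk p ks.
rewrite big_ord_recr /= => pk0.
have mem_take_nth j : (j < k)%N -> s`_j \in ideal_gen (take k s).
  move=> jk; apply: ideal_gen_mem; rewrite -(nth_take 0 jk) mem_nth //.
  by rewrite size_takel // ltnW.
have /ideal_gen_nat[c] : p k \in ideal_gen (take k s).
  apply/qproj_eq0/(regs k ks); rewrite mulr0 -rmorphM; apply/qproj_eq0.
  move/eqP: (pk0); rewrite addrC addr_eq0 mulrC => /eqP->; rewrite rpredN.
  by apply: rpred_sum => j _; apply/ideal_mull/mem_take_nth.
rewrite size_takel ?(ltnW ks) // => pkE.
have /(IHk (fun i => p i + c i * s`_k)) IH :
    \sum_(i < k) (p i + c i * s`_k) * s`_i = 0.
  rewrite -[RHS]pk0 pkE mulr_suml -big_split /=; apply: eq_bigr => i _.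
  by rewrite nth_take // mulrDl mulrAC.
have sk : s`_k \in ideal_gen (take k.+1 s).
  by apply: ideal_gen_mem; rewrite (take_nth 0 ks) mem_rcons mem_head.
move=> i; rewrite ltnS leq_eqVlt => /orP[/eqP->|ik].
  rewrite pkE; apply: rpred_sum => j _.
  apply/ideal_mull/ideal_gen_take_sub => //.
  by rewrite nth_take // mem_take_nth.
rewrite -[p i](addrK (c i * s`_k)) rpredB ?(ideal_mull _ sk) //.
by apply: ideal_gen_take_sub (IH _ i ik); rewrite // ltnW.
Qed.

(* B / B^2 is free over P / B on the classes of a regular sequence. *)
Lemma regular_sequence_coef (B : ideal P) (s : seq P) (p : 'I_(size s) -> P) :
    regular_sequence s -> B =i ideal_gen s ->
    \sum_i p i * s`_i \in ideal_prod B B -> forall i, p i \in B.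
Proof.
move=> regs Bs /(ideal_prod_gen Bs)[b [bB E]] i.
pose q j := oapp (fun i => p i - b i) 0 (insub j).
have qE (j : 'I_(size s)) : q j = p j - b j by rewrite /q valK.
have /(regular_sequence_syzygy regs (leqnn _)) :
    \sum_(i < size s) q i * s`_i = 0.
  under eq_bigr => j _ do rewrite qE mulrBl.
  by rewrite sumrB E subrr.
move/(_ i (ltn_ord i)); rewrite take_size -Bs qE => h.
by rewrite -(subrK (b i) (p i)) rpredD.
Qed.

(** Submodules of P^n are finitely generated: the last coordinates of [L] form a finitely generated
    ideal, and subtracting lifts of its generators reduces to vectors whose last coordinate is 0.
    Only coordinates below [n] matter. *)
Lemma noetherian_fin_gen n (L : (nat -> P) -> Prop) : noetherian P ->
    L (fun=> 0) ->
    (forall a p q, L p -> L q -> L (fun i => a * p i + q i)) ->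
  exists m (g : 'I_m -> nat -> P), (forall l, L (g l)) /\
    forall p, L p -> exists c, forall i, (i < n)%N ->
      p i = \sum_l c l * g l i.
Proof.
move=> noethP; elim: n L => [|n IHn] L L0 Ll.
  by exists 0%N, (fun=> fun=> 0); split=> [[]|] // p _; exists (fun=> 0).
have Lsum k (c : 'I_k -> P) h : (forall l, L (h l)) ->
    L (fun i => \sum_l c l * h l i).
  elim: k c h => [|k IHk] c h Lh.
    rewrite (_ : (fun i => _) = fun=> 0) //.
    by apply/funext => i; rewrite big_ord0.
  rewrite (_ : (fun i => _) = fun i => c ord0 * h ord0 i +
      \sum_(l < k) c (lift ord0 l) * h (lift ord0 l) i).
    by apply: Ll => //; apply: (IHk (c \o lift ord0) (h \o lift ord0)) => l /=.
  by apply/funext => i; rewrite big_ord_recl.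
have cK : ideal_closed (fun x => `[< exists2 p, L p & p n = x >]).
  split=> [|a u v /asboolP[p Lp <-] /asboolP[q Lq <-]]; apply/asboolP.
    by exists (fun=> 0).
  by exists (fun i => a * p i + q i); first exact: Ll.
have [s sK] := noethP (bundle_ideal cK).
have /choice[h hP] : forall l : 'I_(size s), exists h, L h /\ h n = s`_l.
  move=> l; have : s`_l \in ideal_gen s by apply/ideal_gen_mem/mem_nth.
  by rewrite -sK => /asboolP[h Lh hl]; exists h.
have [|a p q [Lp p0] [Lq q0]|m [g [Lg gP]]] := IHn (fun p => L p /\ p n = 0).
- by [].
- by split; [exact: Ll | rewrite p0 q0 mulr0 addr0].
exists (size s + m)%N,
  (fun l => match fintype.split l with inl j => h j | inr j => g j end).
split=> [l|p Lp].
  by case: (fintype.split l) => j; [case: (hP j) | case: (Lg j)].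
have [c pE] : exists c : 'I_(size s) -> P, p n = \sum_i c i * s`_i.
  apply/asboolP; rewrite -[asbool _]/(p n \in ideal_gen s) -sK.
  by apply/asboolP; exists p.
have cn : \sum_l c l * h l n = p n.
  by rewrite pE; apply: eq_bigr => l _; case: (hP l) => _ ->.
have [|d dE] := gP (fun i => (-1) * (\sum_l c l * h l i) + p i).
  split; last by rewrite cn mulN1r addNr.
  by apply: Ll => //; apply: Lsum => l; case: (hP l).
exists (fun l => match fintype.split l with inl j => c j | inr j => d j end).
move=> i.
rewrite big_split_ord /=.
under eq_bigr => j _ do rewrite (unsplitK (inl j)).
under [X in _ = _ + X]eq_bigr => j _ do rewrite (unsplitK (inr j)).
rewrite ltnS leq_eqVlt => /orP[/eqP->|/dE <-]; last by rewrite mulN1r addNKr.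
rewrite cn big1 ?addr0 // => l _; case: (Lg l) => _ ->; exact: mulr0.
Qed.

End RegularSequences.

(** * Submodules and free modules of rows *)

Section Modules.
Variable R : comPzRingType.

Section Submodule.
Variables (V : lmodType R) (C : {pred V}).

Definition bundle_submod of submod_closed C : {pred V} := C.
Variable cC : submod_closed C.
HB.instance Definition _ :=
  GRing.isSubmodClosed.Build R V (bundle_submod cC) cC.

Record submodule : Type := Submodule {
  submodule_val :> V; submodule_valP : submodule_val \in bundle_submod cC }.
HB.instance Definition _ := [isSub for submodule_val].
HB.instance Definition _ := [Choice of submodule by <:].
HB.instance Definition _ := [SubChoice_isSubLmodule of submodule by <:].

End Submodule.

Definition row_comb m (V : lmodType R) (u : 'I_m -> V) (v : 'rV[R]_m) : V :=
  \sum_l v 0 l *: u l.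

Fact row_comb_linear m (V : lmodType R) (u : 'I_m -> V) : linear (row_comb u).
Proof.
move=> a v w; rewrite /row_comb scaler_sumr -big_split /=.
apply: eq_bigr => l _.
by rewrite !mxE scalerDl scalerA.
Qed.
HB.instance Definition _ m (V : lmodType R) (u : 'I_m -> V) :=
  GRing.isLinear.Build R 'rV[R]_m V _ (row_comb u) (row_comb_linear u).

Lemma row_projective m : projective_module 'rV[R]_m.
Proof.
move=> U V g f g_surj.
have /choice[u uE] : forall l, exists u, g u = f (delta_mx 0 l).
  by move=> l; exact: g_surj.
exists (row_comb u) => v.
rewrite [in RHS](row_sum_delta v) /row_comb !linear_sum; apply: eq_bigr => l _.
by rewrite !linearZ uE.
Qed.

Lemma row_fin_gen m : fin_gen 'rV[R]_m.
Proof.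
exists m, (fun l => delta_mx 0 l) => v; exists (fun l => v 0 l).
exact: row_sum_delta.
Qed.

End Modules.

(** * The canonical module as B / A *)

Section CanonicalModule.
Variables (P : comPzRingType) (A B : ideal P).
Local Notation R := (qring (colon A B)).
Local Notation omega := (canonical_module (qmap (@colon_sub P A B))).

(** Multiplication by an element of B; it sends J into A, so the chosen representative of [t] does
    not matter modulo A. This realizes the isomorphism of B/A with the canonical module. *)
Definition theta_fun (b : ideal_mod B)
    (t : restr (qmap (@colon_sub P A B)) R^o) : (qring A)^o :=
  qproj A (ideal_val b * qlift (t : R)).

Lemma theta_funE b p :
  theta_fun b (qproj (colon A B) p) = qproj A (ideal_val b * p).
Proof.
apply/qprojE; rewrite -mulrBr mulrC.
have /colonP : qlift (qproj (colon A B) p) - p \in colon A B.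
  exact/qprojE/qliftK.
by apply; apply: ideal_valP.
Qed.

Fact theta_funP b : theta_fun b \in @linear_pred _ _ (qmap (@colon_sub P A B)).
Proof.
apply/asboolP => a u v; rewrite -(qliftK a) -(qliftK u) -(qliftK v).
have -> : qproj A (qlift a) *: (qproj (colon A B) (qlift u) :
      restr (qmap (@colon_sub P A B)) R^o) + qproj (colon A B) (qlift v) =
    qproj (colon A B) (qlift a * qlift u + qlift v).
  rewrite [RHS]rmorphD rmorphM /= -[in RHS](qmapE (@colon_sub P A B) (qlift a)).
  by [].
rewrite !theta_funE mulrDr mulrCA [LHS]rmorphD; congr (_ + _).
exact: rmorphM.
Qed.

Definition theta (b : ideal_mod B) : omega := CanonicalModule (theta_funP b).

Lemma thetaE b p : theta b (qproj (colon A B) p) = qproj A (ideal_val b * p).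
Proof. exact: theta_funE. Qed.

Lemma canonical_eq (f h : omega) :
  (forall p, f (qproj (colon A B) p) = h (qproj (colon A B) p)) -> f = h.
Proof.
by move=> fh; apply/val_inj/funext => t; rewrite -(qliftK (t : R)); exact: fh.
Qed.

Fact theta_zmod_morphism : zmod_morphism theta.
Proof.
move=> b c; apply: canonical_eq => p; pose r := qproj (colon A B) p.
by rewrite -[RHS]/(theta b r - theta c r) !thetaE mulrBl rmorphB.
Qed.
HB.instance Definition _ :=
  GRing.isZmodMorphism.Build (ideal_mod B) omega theta theta_zmod_morphism.

Lemma thetaZ p b : qproj (colon A B) p *: theta b = theta (p *: b).
Proof.
apply: canonical_eq => q; rewrite thetaE /=.
rewrite -[LHS]/(theta b (qproj (colon A B) p * qproj (colon A B) q)).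
by rewrite -rmorphM thetaE mulrCA mulrA.
Qed.

Lemma theta_eq0 b : theta b = 0 <-> ideal_val b \in A.
Proof.
split=> [b0|bA].
  by apply/qproj_eq0; rewrite -[ideal_val b]mulr1 -thetaE b0.
apply: canonical_eq => p; rewrite thetaE; apply/qproj_eq0.
by rewrite mulrC ideal_mull.
Qed.

Lemma theta_comb_eq0 m (b : 'I_m -> ideal_mod B) (p : 'I_m -> P) :
  row_comb (fun l => theta (b l)) (\row_l qproj (colon A B) (p l)) = 0 <->
  \sum_l p l * ideal_val (b l) \in A.
Proof.
have -> : row_comb (fun l => theta (b l)) (\row_l qproj (colon A B) (p l)) =
    theta (\sum_l p l *: b l).
  by rewrite raddf_sum; apply: eq_bigr => l _; rewrite mxE thetaZ.
rewrite theta_eq0 (big_morph (@ideal_val P B) (id1 := 0) (op1 := +%R)) //.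
Qed.

(* A functional is determined by its value y at 1, and J y <= A. *)
Lemma theta_surj :
    (forall y, (forall j, j \in colon A B -> j * y \in A) -> y \in B) ->
  surjective_map theta.
Proof.
move=> annJ f; have /asboolP fl := canonical_funP f.
have f0 : f 0 = 0 :> qring A.
  by have := fl (-1) 0 0; rewrite scaler0 addr0 scaleN1r addNr.
have fE p : f (qproj (colon A B) p) =
    qproj A p * f (qproj (colon A B) 1) :> qring A.
  have E := fl (qproj A p) (qproj (colon A B) 1) 0.
  rewrite f0 !addr0 in E; apply: etrans E; congr (f _).
  rewrite -[RHS]/(qmap (@colon_sub P A B) (qproj A p) * qproj (colon A B) 1).
  by rewrite qmapE -rmorphM mulr1.
pose y := qlift (f (qproj (colon A B) 1) : qring A).
have yB : y \in B.
  apply: annJ => j jJ; apply/qproj_eq0; rewrite rmorphM /= qliftK -fE.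
  by have -> : qproj (colon A B) j = 0 by apply/qproj_eq0.
exists (IdealMod yB); apply: canonical_eq => p.
by rewrite thetaE fE /= rmorphM /= qliftK mulrC.
Qed.

End CanonicalModule.

(** * The splitting of the second syzygy *)

Section Syzygy.
Variables (P : comPzRingType) (A B : ideal P) (xs : seq P).
Hypotheses (noethP : noetherian P) (sAB2 : {subset A <= ideal_prod B B}).
Hypotheses (gorA : artinian_gorenstein_local (qring A))
  (gorB : artinian_gorenstein_local (qring B)).
Hypotheses (regxs : regular_sequence xs) (size_xs : (2 <= size xs)%N).
Hypothesis genB : B =i ideal_gen xs.
Local Notation J := (colon A B).
Local Notation R := (qring J).
Local Notation n := (size xs).
Local Notation omega := (canonical_module (qmap (@colon_sub P A B))).

Lemma xs_mem (i : 'I_n) : xs`_i \in B.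
Proof. by rewrite genB; apply/ideal_gen_mem/mem_nth. Qed.

Lemma coef_mem (p : 'I_n -> P) :
  \sum_i p i * xs`_i \in ideal_prod B B -> forall i, p i \in B.
Proof. exact: regular_sequence_coef. Qed.

Lemma ideal_subB : {subset A <= B}.
Proof.
move=> a /sAB2/asboolP[k [c [b [_ bB ->]]]].
by apply: rpred_sum => i _; apply: ideal_mull.
Qed.

Lemma colon_annihilator y : (forall j, j \in J -> j * y \in A) -> y \in B.
Proof.
move=> yJ; apply: (quotient_double_annihilator noethP gorA ideal_subB) => z zB.
by rewrite mulrC; apply: yJ; apply/colonP => b bB; rewrite mulrC zB.
Qed.

(* J / A is the canonical module Hom(P/B, P/A) of P / B, hence cyclic and *)
(* isomorphic to P / B.                                                   *)
Lemma colon_generator : exists D, [/\ D \in J,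
  forall p, p * D \in A -> p \in B &
  forall y, y \in J -> exists p, y - p * D \in A].
Proof.
have [s [sA s_unit _]] := quotient_socle noethP gorA.
have [t [tB _ t_ess]] := quotient_socle noethP gorB.
(* [D] is the image of 1 under a map P/B -> P/A carrying the socle generator [t] to the socle
   generator [s]. Being nonzero on the socle, the map is injective, which is the second claim. *)
have [|D [BD tD]] := @quotient_cyclic_ext P A noethP gorA B t s ideal_subB.
  move=> p ptB; have [//|[q qp]] := s_unit p; case/negP: tB.
  rewrite (_ : t = q * (p * t) - (q * p - 1) * t).
    by apply: rpredB; [exact: ideal_mull | exact/ideal_mulr/ideal_subB].
  by rewrite mulrBl mulrA mul1r subKr.
have DJ : D \in J by apply/colonP => b bB; rewrite mulrC BD.
have Dann p : p * D \in A -> p \in B.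
  move=> pD; apply: contraR sA => /t_ess[q qt].
  have -> : s = q * (p * D) - (q * p - t) * D - (t * D - s).
    by rewrite mulrBl mulrA !subKr.
  by apply: rpredB => //; apply: rpredB; [exact: ideal_mull | exact: BD].
exists D; split=> // y yJ.
pose I : ideal P := ideal_add A (ideal_gen [:: D]).
(* Double annihilator of A + (D): whatever kills [D] modulo A lies in B by [Dann], and [y] in J
   kills B modulo A. *)
have /ideal_addP[a aA /ideal_gen1P[p yp]] : y \in I.
  apply: (quotient_double_annihilator noethP gorA) => [|z zI].
    exact: ideal_add_l.
  move/colonP: yJ; apply; apply: Dann; rewrite mulrC; apply: zI.
  by apply/ideal_add_r/ideal_gen_mem; rewrite inE.
by exists p; rewrite -yp subKr.
Qed.

(** Set x_s |-> D and x_t |-> 0 for t <> s. This is well defined: if p x_s lies in A + (x_t : t <>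
    s), freeness of B/B^2 gives p in B, hence p D in A. Self-injectivity makes it multiplication by
    [u]. Since u B <= A + (D) and B D <= A, also B u <= J. *)
Lemma dual_element D (s : 'I_n) : D \in J -> exists u, [/\ u * xs`_s - D \in A,
  forall t : 'I_n, t != s -> u * xs`_t \in A &
  forall b, b \in B -> b * u \in J].
Proof.
move=> DJ.
have cI : ideal_closed (fun y => `[< exists c : 'I_n -> P,
    y - \sum_(t | t != s) c t * xs`_t \in A >]).
  split=> [|a u v /asboolP[c uc] /asboolP[d vd]]; apply/asboolP.
    by exists (fun=> 0); rewrite big1 ?subr0 ?rpred0 // => t _; rewrite mul0r.
  exists (fun t => a * c t + d t).
  under eq_bigr => t _ do rewrite mulrDl -mulrA.
  by rewrite big_split -mulr_sumr opprD addrACA -mulrBr rpredD ?ideal_mull.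
have sAI : {subset A <= bundle_ideal cI}.
  move=> a aA; apply/asboolP; exists (fun=> 0).
  by rewrite big1 ?subr0 // => t _; rewrite mul0r.
have [|u [Iu xu]] := @quotient_cyclic_ext P A noethP gorA _ xs`_s D sAI.
  move=> p /asboolP[c pc]; rewrite mulrC; move/colonP: DJ; apply.
  have h : \sum_t (if t == s then p else - c t) * xs`_t \in ideal_prod B B.
    rewrite (bigD1 s) //= eqxx; apply: sAB2.
    rewrite -[X in _ + X]opprK -sumrN.
    rewrite (eq_bigr (fun t => c t * xs`_t)) // => t /negbTE ->.
    by rewrite mulNr opprK.
  by have /= := coef_mem h s; rewrite ?eqxx.
have ut (t : 'I_n) : t != s -> u * xs`_t \in A.
  move=> ts; rewrite mulrC; apply: Iu; apply/asboolP.
  exists (fun r => (r == t)%:R).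
  rewrite (bigD1 t) //= eqxx mul1r big1 ?addr0 ?subrr ?rpred0 //.
  by move=> r /andP[_ /negbTE ->]; rewrite mul0r.
exists u; split=> //; first by rewrite mulrC.
move=> b bB; apply/colonP => y; rewrite genB => /ideal_gen_nat[c ->].
rewrite mulr_sumr; apply: rpred_sum => t _; rewrite mulrCA -mulrA ideal_mull //.
have [->|/ut utA] := eqVneq t s; last exact: ideal_mull.
rewrite -(subrK D (u * _)) mulrDr rpredD //.
  by rewrite ideal_mull 1?mulrC.
by move/colonP: DJ => DB; rewrite mulrC DB.
Qed.

Lemma relation_generators : exists m (g : 'I_m -> 'I_n -> P),
  (forall l, \sum_i g l i * xs`_i \in A) /\
  forall p : 'I_n -> P, \sum_i p i * xs`_i \in A ->
    exists c, forall i, p i = \sum_l c l * g l i.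
Proof.
have [||m [g [gA gP]]] := @noetherian_fin_gen P n
  (fun p => \sum_(i < n) p i * xs`_i \in A) noethP.
- by rewrite big1 ?rpred0 // => i _; rewrite mul0r.
- move=> a p q pA qA; under eq_bigr => i _ do rewrite mulrDl -mulrA.
  by rewrite big_split -mulr_sumr rpredD ?ideal_mull.
exists m, (fun l i => g l i); split=> // p pA.
have [|c cP] := gP (fun i => oapp p 0 (insub i)).
  by under eq_bigr => i _ do rewrite valK.
by exists c => i; rewrite -cP ?ltn_ord // valK.
Qed.

(* The Koszul relation x_s' e_s - x_s e_s', where s' <> s, becomes D e_s      *)
(* modulo A when multiplied by an element u acting on B / A as the functional *)
(* that sends x_s' to D and the other generators to 0.                        *)
Lemma koszul_section m (g : 'I_m -> 'I_n -> P) D : D \in J ->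
    (forall p : 'I_n -> P, \sum_i p i * xs`_i \in A ->
      exists c, forall i, p i = \sum_l c l * g l i) ->
  exists c : 'I_n -> 'I_m -> P,
    (forall s i, \sum_l c s l * g l i - (i == s)%:R * D \in A) /\
    forall s l b, b \in B -> b * c s l \in J.
Proof.
move=> DJ gP; suff /choice[c cP] : forall s, exists c : 'I_m -> P,
    (forall i, \sum_l c l * g l i - (i == s)%:R * D \in A) /\
    forall l b, b \in B -> b * c l \in J.
  by exists c; split=> s; case: (cP s).
(* The length of the sequence being at least two provides a second index for a Koszul relation. *)
move=> s; have [s' s's] : exists s' : 'I_n, s' != s.
  have n0 : (0 < n)%N by apply: leq_trans size_xs.
  have [->|s0] := eqVneq s (Ordinal n0); first by exists (Ordinal size_xs).
  by exists (Ordinal n0); rewrite eq_sym.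
have [u [us' ut uB]] := dual_element s' DJ.
pose k i := if i == s then xs`_s' else if i == s' then - xs`_s else 0.
have [|c cE] := gP k.
  rewrite (bigD1 s) //= (bigD1 s') //= /k eqxx (negbTE s's) eqxx.
  rewrite big1 ?addr0 => [|i /andP[/negbTE-> /negbTE->]]; last by rewrite mul0r.
  by rewrite mulNr mulrC subrr rpred0.
exists (fun l => u * c l); split=> [i|l b bB].
  under eq_bigr => l _ do rewrite -mulrA.
  rewrite -mulr_sumr -cE /k.
  have [_|_] := eqVneq i s; first by rewrite mul1r.
  rewrite mul0r subr0; have [_|_] := eqVneq i s'; last by rewrite mulr0 rpred0.
  by rewrite mulrN rpredN ut // eq_sym.
by rewrite mulrA ideal_mulr // uB.
Qed.

Lemma conormal_coord (b : ideal_mod B) : exists p : 'I_n -> P,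
  ideal_val b = \sum_i p i * xs`_i.
Proof.
by have := ideal_valP b; rewrite genB => /ideal_gen_nat[c ->]; exists c.
Qed.

(** * The free presentation of the canonical module and the decomposition of its kernel *)

Section Splitting.
Variables (m : nat) (g : 'I_m -> 'I_n -> P) (D : P) (c : 'I_n -> 'I_m -> P).
Hypothesis gA : forall l, \sum_i g l i * xs`_i \in A.
Hypothesis gP : forall p : 'I_n -> P, \sum_i p i * xs`_i \in A ->
  exists c, forall i, p i = \sum_l c l * g l i.
Hypotheses (DJ : D \in J) (Dann : forall p, p * D \in A -> p \in B).
Hypothesis Dgen : forall y, y \in J -> exists p, y - p * D \in A.
Hypothesis cD : forall s i, \sum_l c s l * g l i - (i == s)%:R * D \in A.
Hypothesis cB : forall s l b, b \in B -> b * c s l \in J.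

Lemma g_mem l i : g l i \in B.
Proof. by apply: coef_mem; apply: sAB2. Qed.

Definition x_mod (i : 'I_n) : ideal_mod B := IdealMod (xs_mem i).
Definition g_mod (i : 'I_n) (l : 'I_m) : ideal_mod B := IdealMod (g_mem l i).

Definition row_q k (p : 'I_k -> P) : 'rV[R]_k := \row_l qproj J (p l).

Lemma row_qK k (v : 'rV[R]_k) : v = row_q (fun l => qlift (v 0 l)).
Proof. by apply/rowP => l; rewrite mxE qliftK. Qed.

Lemma row_q_eq k (p q : 'I_k -> P) :
  row_q p = row_q q <-> forall l, p l - q l \in J.
Proof.
split=> [/rowP pq l|pq]; first by have := pq l; rewrite !mxE => /qprojE.
by apply/rowP => l; rewrite !mxE; apply/qprojE.
Qed.

Definition augmentation : 'rV[R]_n -> omega :=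
  row_comb (fun i => theta A (x_mod i)).
HB.instance Definition _ := GRing.Linear.on augmentation.

Definition relations : 'rV[R]_m -> 'rV[R]_n := row_comb (fun l => row_q (g l)).
HB.instance Definition _ := GRing.Linear.on relations.

Lemma relationsE p : relations (row_q p) = row_q (fun i => \sum_l p l * g l i).
Proof.
apply/rowP => i; rewrite summxE !mxE rmorph_sum; apply: eq_bigr => l _.
by rewrite !mxE rmorphM.
Qed.

Lemma relations_eq0 p :
  relations (row_q p) = 0 <-> forall i, \sum_l p l * g l i \in J.
Proof.
have -> : 0 = row_q (fun=> 0) :> 'rV[R]_n.
  by apply/rowP => i; rewrite !mxE rmorph0.
by rewrite relationsE row_q_eq; split=> h i; have := h i; rewrite subr0.
Qed.

Lemma augmentation_exact : exact_at relations augmentation.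
Proof.
move=> v; rewrite (row_qK v); split=> [/theta_comb_eq0/gP[d dP]|[w <-]].
  exists (row_q d); rewrite relationsE; apply/row_q_eq => i.
  by rewrite dP subrr rpred0.
rewrite (row_qK w) relationsE; apply/theta_comb_eq0.
under eq_bigr => i _ do rewrite mulr_suml.
rewrite exchange_big; apply: rpred_sum => l _.
under eq_bigr => i _ do rewrite -mulrA.
by rewrite -mulr_sumr ideal_mull.
Qed.

Lemma augmentation_surj : surjective_map augmentation.
Proof.
move=> f; have [b <-] := theta_surj colon_annihilator f.
have [p bE] := conormal_coord b; exists (row_q p).
rewrite (_ : b = \sum_i p i *: x_mod i).
  by rewrite raddf_sum; apply: eq_bigr => i _; rewrite mxE thetaZ.
apply/val_inj => /=.
by rewrite (big_morph (@ideal_val P B) (id1 := 0) (op1 := +%R)).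
Qed.

(* The vectors v such that the coordinates of sum_l v_l g_l, which lie in B,  *)
(* vanish in B / A; a general relation only has them vanish in B / J.         *)
Definition complement_pred : {pred 'rV[R]_m} :=
  fun v => `[< forall i, row_comb (fun l => theta A (g_mod i l)) v = 0 >].

Fact complement_closed : submod_closed complement_pred.
Proof.
split=> [|a v w /asboolP v0 /asboolP w0]; apply/asboolP => i.
  by rewrite linear0.
by rewrite linearP /= v0 w0 scaler0 addr0.
Qed.
Local Notation C := (submodule complement_closed).

Lemma complement_row_q p :
  row_q p \in complement_pred <-> forall i, \sum_l p l * g l i \in A.
Proof.
split=> [/asboolP pC i|pA]; first by have /theta_comb_eq0 := pC i.
by apply/asboolP => i; apply/theta_comb_eq0; exact: pA.
Qed.

Definition coord (b : ideal_mod B) : 'I_n -> P := sval (cid (conormal_coord b)).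

Lemma coordE b : ideal_val b = \sum_i coord b i * xs`_i.
Proof. by rewrite /coord; case: cid. Qed.

Definition conormal_section (t : conormal sAB2) : 'rV[R]_m :=
  row_q (fun l => \sum_s coord (conormal_lift t) s * c s l).

(** Independence of the chosen coordinates: elements congruent modulo B^2 have coordinates congruent
    modulo B, and B c <= J by [cB]. *)
Lemma conormal_sectionE b (p : 'I_n -> P) : ideal_val b = \sum_i p i * xs`_i ->
  conormal_section (conormal_proj sAB2 b) = row_q (fun l => \sum_s p s * c s l).
Proof.
move=> bE; apply/row_q_eq => l; rewrite -sumrB; apply: rpred_sum => s _.
rewrite -mulrBl; apply: cB; apply: (coef_mem (p := fun s => _ s - p s)).
under eq_bigr => i _ do rewrite mulrBl.
by rewrite sumrB -coordE -bE; apply/(conormal_projE sAB2)/conormal_liftK.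
Qed.

Fact conormal_section_linear : linear conormal_section.
Proof.
move=> a t u; rewrite -(qliftK a) -(conormal_liftK t) -(conormal_liftK u).
set b := conormal_lift t; set d := conormal_lift u; set r := qlift a.
have -> : qproj J r *: conormal_proj sAB2 b = conormal_proj sAB2 (r *: b).
  exact: conormal_scaleE.
rewrite -raddfD.
rewrite (@conormal_sectionE (r *: b + d) (fun i => r * coord b i + coord d i)).
  rewrite !(conormal_sectionE (coordE _)); apply/rowP => l; rewrite !mxE.
  rewrite -rmorphM -rmorphD mulr_sumr -big_split; congr (qproj _ _).
  by apply: eq_bigr => s _; rewrite /= mulrDl mulrA.
rewrite /= [in LHS](coordE b) [in LHS](coordE d) mulr_sumr -big_split.
by apply: eq_bigr => i _; rewrite /= mulrDl mulrA.
Qed.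
HB.instance Definition _ :=
  GRing.isLinear.Build R _ _ _ conormal_section conormal_section_linear.

Definition splitting (tz : (conormal sAB2 * C)%type) : 'rV[R]_m :=
  conormal_section tz.1 + submodule_val tz.2.

Fact splitting_linear : linear splitting.
Proof.
move=> a [t z] [t' z']; rewrite /splitting /= linearP scalerDr addrACA.
by [].
Qed.
HB.instance Definition _ :=
  GRing.isLinear.Build R _ _ _ splitting splitting_linear.

(** Following the section by psi gives p |-> p D, that is, the isomorphism (P/B)^n = (J/A)^n. *)
Lemma section_relation p i :
  \sum_l (\sum_s p s * c s l) * g l i - p i * D \in A.
Proof.
under eq_bigr => l _ do rewrite mulr_suml.
rewrite exchange_big /=.
rewrite (_ : _ - _ = \sum_s p s * (\sum_l c s l * g l i - (i == s)%:R * D)).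
  by apply: rpred_sum => s _; apply: ideal_mull.
under [RHS]eq_bigr => s _ do rewrite mulrBr mulr_sumr.
rewrite sumrB; congr (_ - _).
  by apply: eq_bigr => s _; apply: eq_bigr => l _; rewrite mulrA.
rewrite (bigD1 i) //= eqxx mul1r big1 ?addr0 // => s si.
by rewrite eq_sym (negbTE si) mul0r mulr0.
Qed.

(** On a kernel element the section part lies in the complement, so every p_i D is in A, every
    coordinate p_i is in B, and b = sum_i p_i x_i is in B^2. *)
Lemma splitting_inj : injective splitting.
Proof.
apply: raddf_inj => -[t z]; rewrite /= /splitting /= -(conormal_liftK t).
set b := conormal_lift t; rewrite (conormal_sectionE (coordE b)) => /eqP.
rewrite addr_eq0 => /eqP bz.
have /complement_row_q bC : row_q (fun l => \sum_s coord b s * c s l)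
    \in complement_pred.
  have := submodule_valP (- z); rewrite /= -bz; exact.
have bB i : coord b i \in B.
  apply: Dann.
  rewrite -[_ * D](subKr (\sum_l (\sum_s coord b s * c s l) * g l i)).
  by rewrite rpredB ?bC // section_relation.
have b0 : conormal_proj sAB2 b = 0.
  rewrite -(raddf0 (conormal_proj sAB2)); apply/(conormal_projE sAB2).
  rewrite subr0 coordE; apply/asboolP.
  by exists n, (coord b), (fun i => xs`_i); split=> // i; apply: xs_mem.
have z0 : z = 0.
  apply/val_inj/eqP; rewrite /= -oppr_eq0 -bz -(conormal_sectionE (coordE b)).
  by rewrite b0 linear0.
by rewrite b0 z0.
Qed.

(** For a kernel row [w], each coordinate of sum_l w_l g_l lies in J, hence is p_i D modulo A.
    Subtracting the section of sum_i p_i x_i leaves a row of the complement. Conversely, both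
    summands land in the kernel since D is in J and A <= J. *)
Lemma splitting_exact : exact_at splitting relations.
Proof.
move=> v; split=> [|[[t z] <-]].
  have [w ->] : exists w, v = row_q w by eexists; exact: row_qK.
  move=> /relations_eq0 wJ.
  have /choice[p pE] : forall i, exists p, \sum_l w l * g l i - p * D \in A.
    by move=> i; apply/Dgen/wJ.
  pose b := \sum_i p i *: x_mod i.
  have bE : ideal_val b = \sum_i p i * xs`_i.
    by rewrite /b (big_morph (@ideal_val P B) (id1 := 0) (op1 := +%R)).
  have zP : row_q (fun l => w l - \sum_s p s * c s l) \in complement_pred.
    apply/complement_row_q => i; under eq_bigr => l _ do rewrite mulrBl.
    rewrite sumrB -[X in X - _](subrK (p i * D)) -addrA.
    by rewrite rpredD // -opprB rpredN section_relation.
  exists (conormal_proj sAB2 b, Submodule zP : C).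
  rewrite /splitting /= (conormal_sectionE bE); apply/rowP => l.
  by rewrite !mxE rmorphB addrC subrK.
rewrite /splitting linearD /= -(conormal_liftK t).
rewrite (conormal_sectionE (coordE _)); set p := coord _.
have -> : relations (row_q (fun l => \sum_s p s * c s l)) = 0.
  apply/relations_eq0 => i; rewrite -(subrK (p i * D) (\sum_l _)) rpredD //.
    exact/colon_sub/section_relation.
  exact: ideal_mull.
have := submodule_valP z; rewrite (row_qK (submodule_val z)) add0r.
by move/complement_row_q => zA; apply/relations_eq0 => i; apply/colon_sub.
Qed.

Lemma splitting_second_syzygy : exists N : lmodType R,
  second_syzygy omega N /\ has_summand_iso N (conormal sAB2).
Proof.
(* The direct sum itself is taken as the second syzygy, embedded in R^m by [splitting], so the
   summand statement holds by the identity map. *)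
exists (conormal sAB2 * C)%type; split; last first.
  by exists C, idfun; exists id.
exists 'rV[R]_n, 'rV[R]_m, splitting, relations, augmentation; split.
- by split; [exact: row_projective | exact: row_fin_gen].
- by split; [exact: row_projective | exact: row_fin_gen].
- exact: splitting_inj.
- exact: splitting_exact.
- by split; [exact: augmentation_exact | exact: augmentation_surj].
Qed.

End Splitting.

End Syzygy.

Theorem theorem1p2 (P : comPzRingType) (A B : ideal P) (xs : seq P)
    (noethP : noetherian P)
    (sAB2 : {subset A <= ideal_prod B B})
    (gorA : artinian_gorenstein_local (qring A))
    (gorB : artinian_gorenstein_local (qring B))
    (regxs : regular_sequence xs)
    (size_xs : (2 <= size xs)%N)
    (genB : B =i ideal_gen xs) :
  exists N : lmodType (qring (colon A B)),
    second_syzygy (canonical_module (qmap (@colon_sub P A B))) N /\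
    has_summand_iso N (conormal sAB2).
Proof.
have [D [DJ Dann Dgen]] := colon_generator noethP sAB2 gorA gorB.
have [m [g [gA gP]]] := relation_generators A xs noethP.
have [c [cD cB]] := koszul_section noethP sAB2 gorA regxs size_xs genB DJ gP.
exact: (splitting_second_syzygy noethP sAB2 gorA regxs genB gA gP DJ Dann Dgen
  cD cB).
Qed.
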